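(* Let $G$ be a connected finite simple graph, and let $G^*$ be the tree obtained from $G$ by contracting, to a single vertex each, all connected components with at least two vertices of the graph $G'=(V(G),E(G)\setminus B)$, where $B$ is the set of cut-edges of $G$. Then $pc(G)\le \max\{3,\Delta(G^* )\}$.
   Context: All graphs are finite and simple. In an edge-colored graph (adjacent edges may have the same color), a path is proper if no two adjacent edges of the path have the same color. An edge-coloring of a connected graph $G$ is a proper-path coloring if every two distinct vertices of $G$ are connected by a proper path. The proper connection number $pc(G)$ is the smallest number of colors in a proper-path coloring of $G$. $\Delta(\cdot)$ denotes maximum degree. Construction of $G^*$: let $B\subseteq E(G)$ be the set of cut-edges (bridges) of $G$. Each connected component of $(V(G),E(G)\setminus B)$ is either a single vertex or a connected bridgeless subgraph of $G$ with more than one vertex. Contracting each component of the latter type to a vertex yields $G^*$, which is a tree with edge set $B$ (so its vertices correspond to the components of $(V(G),E(G)\setminus B)$). *)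

(* Defs.v *)
From mathcomp Require Import all_boot.
From mathcomp Require Import boolp.

Set Implicit Arguments.
Unset Strict Implicit.
Unset Printing Implicit Defensive.

Record sgraph := SGraph {
  vertex :> finType;
  adj : rel vertex;
  adj_sym : symmetric adj;
  adj_irr : irreflexive adj }.

Arguments adj {s} x y : rename.

Definition connected (G : sgraph) : Prop :=
  0 < #|G| /\ forall x y : G, connect adj x y.

Definition max_degree (G : sgraph) : nat :=
  \max_(x : G) #|[set y : G | adj x y]|.

Definition edges (G : sgraph) : {set {set G}} :=
  [set [set p.1; p.2] | p : G * G & adj p.1 p.2].

Definition edge (G : sgraph) : finType := {A : {set G} | A \in edges G}.

Definition adjacent_edges (G : sgraph) (a b : edge G) : bool :=
  (a != b) && (val a :&: val b != set0).

Definition is_path (G : sgraph) (x : G) (p : seq G) (y : G) : bool :=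
  [&& path adj x p, last x p == y & uniq (x :: p)].

Definition path_edges (G : sgraph) (x : G) (p : seq G) : seq {set G} :=
  pairmap (fun u v => [set u; v]) x p.

Definition proper (G : sgraph) (k : nat) (c : edge G -> 'I_k)
    (x : G) (p : seq G) : Prop :=
  forall a b : edge G,
    val a \in path_edges x p -> val b \in path_edges x p ->
    adjacent_edges a b -> c a != c b.

Definition proper_path_coloring (G : sgraph) (k : nat) (c : edge G -> 'I_k)
    : Prop :=
  forall x y : G, x != y -> exists2 p, is_path x p y & proper c x p.

Lemma proper_path_coloring_ex (G : sgraph) : connected G ->
  exists k, `[< exists c : edge G -> 'I_k, proper_path_coloring c >].
Proof.
move=> [_ Gconn]; exists #|edge G|; apply/asboolP; exists enum_rank => x y _.
have /connectP[p xp ->] := Gconn x y.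
case/shortenP: xp => q xq uq _; exists q; first by rewrite /is_path xq eqxx uq.
by move=> a b _ _ /andP[ab _]; rewrite (inj_eq enum_rank_inj).
Qed.

Definition pc (G : sgraph) (Gconn : connected G) : nat :=
  ex_minn (proper_path_coloring_ex Gconn).

Section DeleteEdges.
Variables (G : sgraph) (B : {set {set G}}).

Definition del_adj : rel G := [rel x y | adj x y && ([set x; y] \notin B)].

Lemma del_adj_sym : symmetric del_adj.
Proof. by move=> x y; rewrite /del_adj /= adj_sym setUC. Qed.

Lemma del_adj_irr : irreflexive del_adj.
Proof. by move=> x; rewrite /del_adj /= adj_irr. Qed.

Definition del_edges : sgraph := SGraph del_adj_sym del_adj_irr.

End DeleteEdges.

Definition num_components (G : sgraph) : nat := n_comp (@adj G) G.

Definition cut_edges (G : sgraph) : {set {set G}} :=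
  [set A in edges G | num_components G < num_components (del_edges [set A])].

Definition components (G : sgraph) : {set {set G}} :=
  equivalence_partition (connect (@adj G)) [set: G].

(* Contraction of every block of a family P of vertex sets to a single
   vertex. Loops and parallel edges are discarded. *)
Section Contract.
Variables (G : sgraph) (P : {set {set G}}).

Definition block : finType := {C : {set G} | C \in P}.

Definition contract_adj : rel block := fun C D =>
  (C != D) && [exists x in val C, exists y in val D, adj x y].

Lemma contract_adj_sym : symmetric contract_adj.
Proof.
move=> C D; rewrite /contract_adj eq_sym; congr (_ && _).
apply/exists_inP/exists_inP=> -[x xC /exists_inP[y yD xy]];
  by exists y => //; apply/exists_inP; exists x => //; rewrite adj_sym.
Qed.

Lemma contract_adj_irr : irreflexive contract_adj.
Proof. by move=> C; rewrite /contract_adj eqxx. Qed.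

Definition contract : sgraph := SGraph contract_adj_sym contract_adj_irr.

End Contract.

(* One-vertex components are blocks too: contracting them changes nothing.
   When G is connected two components are joined by at most one edge, so no
   parallel edge is lost: the edges of the result are the cut-edges of G. *)
Definition bridge_tree (G : sgraph) : sgraph :=
  contract (components (del_edges (cut_edges G)) : {set {set G}}).

(* Main.v *)
Require Import Defs.
From mathcomp Require Import all_boot.
From mathcomp Require Import boolp.

(* A component C of G minus its bridges has a spanning subgraph built from a
   vertex by ears with at least one new vertex each. Orienting the ears makes it
   strongly connected, and it is 2-degenerate, hence has a proper vertex
   3-colouring g. Giving the arc x -> y the colour g y makes every directed path
   proper. Going from x to y forwards or backwards provides two proper paths,
   one leaving x with a colour other than g x and reaching y with colour g y,
   the other leaving x with g x and reaching y with a colour other than g y.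
   Moreover, if s x is the colour of the first arc leaving x along its own ear,
   then for any x and y, one of the two reaches the other by a directed path
   starting with s.

   With k = max (3, Delta) colours, Delta being that of the bridge tree, the at
   most k bridges leaving C are coloured so that any two of them are joined
   through C: if they leave from at least three vertices, each vertex has at
   most k - 2 of them, and these can avoid both g and s; if they leave from two
   vertices, each has at most k - 1, which avoid the end colours of one path
   between the two; if they all leave from one vertex, being distinct suffices.
   Colourings of different components are then glued along bridges, after
   swapping two colours in one of them so that they agree on the common bridge. *)

Set Implicit Arguments.
Unset Strict Implicit.
Unset Printing Implicit Defensive.

(** * Bridges *)

Section Bridges.
Variable G : sgraph.
Hypothesis Gconn : connected G.

Definition minus_edge (x y : G) : rel G := del_adj [set [set x; y]].

Lemma set2_eq (T : finType) (x y a b : T) :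
  [set x; y] = [set a; b] -> (x = a /\ y = b) \/ (x = b /\ y = a).
Proof.
move=> E.
have: x \in [set a; b] by rewrite -E set21.
have: y \in [set a; b] by rewrite -E set22.
have: a \in [set x; y] by rewrite E set21.
have: b \in [set x; y] by rewrite E set22.
by rewrite !inE => /orP[]/eqP ? /orP[]/eqP ? /orP[]/eqP ? /orP[]/eqP ?;
  subst; auto.
Qed.

Lemma minus_edgeI (x y a b : G) :
  adj a b -> (a != x) || (b != y) -> (a != y) || (b != x) ->
  minus_edge x y a b.
Proof.
move=> ab h1 h2; rewrite /minus_edge /del_adj /= ab /= inE.
by apply/eqP=> /set2_eq[][E1 E2]; move: h1 h2; rewrite E1 E2 !eqxx.
Qed.

Lemma minus_edge_sym (x y : G) : connect_sym (minus_edge x y).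
Proof. by apply: sym_connect_sym; apply: del_adj_sym. Qed.

Lemma num_components_le1 (H : sgraph) :
  (forall x y : H, connect adj x y) -> num_components H <= 1.
Proof.
move=> conn; rewrite /num_components /n_comp_mem.
rewrite leqNgt; apply/negP=> /card_gt1P[x [y []]].
rewrite !inE !andbT => rx ry /eqP; apply; rewrite -(eqP rx) -(eqP ry).
by apply/rootP/conn; apply/sym_connect_sym/adj_sym.
Qed.

(** [G] has exactly one component. If [x] and [y] stay connected without [xy], every walk can be
    rerouted and one component remains; otherwise their roots differ. *)
Lemma cut_edgeE (x y : G) : adj x y ->
  ([set x; y] \in cut_edges G) = ~~ connect (minus_edge x y) x y.
Proof.
move=> xy; have [G0 conn] := Gconn.
have xyE : [set x; y] \in edges G by apply/imsetP; exists (x, y); rewrite ?inE.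
rewrite inE xyE /=.
have n1 : num_components G = 1.
  apply/eqP; rewrite eqn_leq num_components_le1 //=.
  apply/card_gt0P; exists (root (@adj G) x).
  by rewrite !inE andbT roots_root //; apply/sym_connect_sym/adj_sym.
rewrite n1.
have cs : connect_sym (minus_edge x y) by apply: minus_edge_sym.
have [cxy|ncxy] /= := boolP (connect _ _ _).
  apply/negbTE; rewrite -leqNgt; apply: num_components_le1 => a b.
  apply: (connect_sub _ (conn a b)) => {}a {}b ab.
  have [/eqP|ne] := boolP ([set a; b] == [set x; y]).
    by case/set2_eq=> [][-> ->] //; rewrite /= in cs *; rewrite cs.
  by apply: connect1; rewrite /= /del_adj /= ab inE ne.
apply/card_gt1P; exists (root (minus_edge x y) x), (root (minus_edge x y) y).
by split; rewrite ?inE ?andbT ?roots_root // root_connect.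
Qed.

Definition nonbridge : rel G := del_adj (cut_edges G).

Lemma nonbridge_sym : connect_sym nonbridge.
Proof. by apply: sym_connect_sym; apply: del_adj_sym. Qed.

Lemma nonbridgeE (x y : G) :
  nonbridge x y = adj x y && connect (minus_edge x y) x y.
Proof.
rewrite /nonbridge /del_adj /=; case xy: (adj x y) => //=.
by rewrite cut_edgeE // negbK.
Qed.

(* Truncating a walk at its first visit to [x] removes the arcs leaving [x]. *)
Lemma connect_avoid (e : rel G) (x y : G) :
  connect e y x -> connect [rel a b | e a b && (a != x)] y x.
Proof.
case/connectP=> p; elim: p y => [|z p IH] y /=; first by move=> _ ->.
case/andP=> yz zp lp; have [->|yx] := eqVneq y x; first exact: connect0.
by apply: connect_trans (IH z zp lp); apply: connect1; rewrite /= yz.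
Qed.

End Bridges.

Arguments nonbridge {G}.

(** * Oriented ear decompositions *)

Section Ears.
Variable G : sgraph.
Hypothesis Gconn : connected G.
Implicit Types (T : {set G}) (D : rel G) (g s : G -> nat).

(** An arc is coloured by its head, so [g (head x p)] is the colour of the first arc of a nonempty
    path. *)
Definition starts D g s (x y : G) : Prop :=
  exists p, [/\ path D x p, last x p = y, uniq (x :: p) & g (head x p) = s x].

(* An arc [x -> y] of [D] gets the colour [g y]. When [t = u] the digraph [D]
   is strongly connected on [T]; otherwise it becomes so with the additional
   arc [u -> t]. *)
Record ears (t u : G) T D g s : Prop := Ears {
  ears_top : t \in T;
  ears_bot : u \in T;
  ears_sub : forall x y, D x y -> [/\ adj x y, x \in T & y \in T];
  ears_asym : forall x y, D x y -> ~~ D y x;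
  ears_proper : forall x y, D x y -> g x != g y;
  ears_lt3 : forall x, g x < 3;
  ears_conn : forall x, x \in T -> connect D t x /\ connect D x u;
  ears_starts : forall x y, x \in T -> y \in T -> x != y ->
    starts D g s x y \/ starts D g s y x }.

Lemma ears_init (r : G) : exists T D g s, ears r r T D g s.
Proof.
exists [set r], (fun _ _ => false), (fun=> 0), (fun=> 0).
split=> //; rewrite ?set11 //; first by move=> x /set1P ->.
by move=> x y /set1P-> /set1P->; rewrite eqxx.
Qed.

Lemma ears_strong u T D g s x y : ears u u T D g s ->
  x \in T -> y \in T -> connect D x y.
Proof.
by move=> H /(ears_conn H)[_ xu] /(ears_conn H)[uy _]; apply: connect_trans uy.
Qed.

Lemma ears_path t u T D g s x p : ears t u T D g s ->
  path D x p -> all (mem T) p.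
Proof.
move=> H; elim: p x => //= y p IH x /andP[/(ears_sub H)[_ _ ->] /IH] //.
Qed.

Lemma avoid2 (a b : nat) : exists2 c, c < 3 & (c != a) && (c != b).
Proof.
case: a b => [|[|a]] [|[|b]];
 by [exists 0|exists 1|exists 2].
Qed.

Lemma starts_sub D D' g g' s s' x y : subrel D D' ->
  (forall a b, D a b -> g' b = g b) -> x != y -> s' x = s x ->
  starts D g s x y -> starts D' g' s' x y.
Proof.
move=> DD gg xy ss [[|z p] [/= pp lp up hp]]; first by rewrite lp eqxx in xy.
exists (z :: p); split=> //=; last by case/andP: pp => /gg-> _; rewrite ss.
by case/andP: pp => /DD -> /(sub_path DD).
Qed.

(** The new vertex gets the single arc [w -> t]. Every vertex of [T] is reachable from [t], so [w]
    reaches all of them by paths with first colour [s' w = g t]; old pairs keep their paths. *)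
Lemma ears_add t u T D g s w : ears t u T D g s -> w \notin T -> adj w t ->
  exists D' g' s', [/\ ears w u (w |: T) D' g' s', g' w != g' u &
    forall y, D' w y = (y == t)].
Proof.
move=> H wT wt.
(* Avoiding [g t] keeps the colouring proper on [w -> t]; avoiding [g u] does so on an arc [u -> w],
   should the ear be closed there. *)
have [c c3 /andP[ct cu]] := avoid2 (g t) (g u).
pose D' : rel G := fun x y => D x y || ((x == w) && (y == t)).
pose g' x := if x == w then c else g x.
pose s' x := if x == w then g t else s x.
have nw x : x \in T -> (x == w) = false.
  by move=> xT; apply/eqP=> E; rewrite -E xT in wT.
have tT := ears_top H; have uT := ears_bot H.
have DT := ears_sub H.
have gT x : x \in T -> g' x = g x by move=> /nw; rewrite /g' => ->.
have DD : subrel D D' by move=> x y; rewrite /D' => ->.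
have CC x y : connect D x y -> connect D' x y.
  by apply: connect_sub => a b /DD/connect1.
have Dw y : D w y = false.
  by apply/negP=> /DT[_ wT' _]; rewrite wT' in wT.
have Dw' y : D y w = false.
  by apply/negP=> /DT[_ _ wT']; rewrite wT' in wT.
have tnw := nw _ tT.
exists D', g', s'; split; last by move=> y; rewrite /D' Dw eqxx.
  split.
  - by rewrite setU11.
  - by rewrite setU1r.
  - move=> x y /orP[/DT[-> xT yT]|/andP[/eqP-> /eqP->]].
      by rewrite !setU1r.
    by rewrite wt setU11 setU1r.
  - move=> x y; rewrite /D' => /orP[xy|/andP[/eqP-> /eqP->]].
      have [_ xT yT] := DT _ _ xy.
      by rewrite negb_or (ears_asym H xy) (nw y).
    by rewrite Dw' tnw.
  - move=> x y; rewrite /D' => /orP[xy|/andP[/eqP-> /eqP->]].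
      have [_ xT yT] := DT _ _ xy.
      by rewrite !gT // (ears_proper H).
    by rewrite (gT t) // /g' eqxx.
  - by move=> x; rewrite /g'; case: ifP => // _; apply: (ears_lt3 H).
  - have wt' : connect D' w t by apply: connect1; rewrite /D' !eqxx orbT.
    move=> x /setU1P[->|xT].
      split=> //; apply: connect_trans wt' _.
      by apply: CC; case: (ears_conn H tT).
    have [tx xu] := ears_conn H xT.
    by split; [apply: connect_trans wt' _; apply: CC|apply: CC].
  - have W y : y \in T -> starts D' g' s' w y.
      move=> yT; have [/connectP[p0 p0P ->] _] := ears_conn H yT.
      case/shortenP: p0P => p pP up _.
      exists (t :: p); split=> //=; last first.
      + by rewrite gT // /s' eqxx.
      + rewrite -/(uniq (t :: p)) up andbT.
        apply/negP; rewrite inE eq_sym tnw /=.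
        by move/(allP (ears_path H pP)) => /= wT'; rewrite wT' in wT.
      + by rewrite (sub_path DD pP) andbT /D' !eqxx orbT.
    have S x y : x \in T -> y \in T -> x != y ->
      starts D g s x y -> starts D' g' s' x y.
      move=> xT yT xy; apply: starts_sub => //.
        by move=> a b /DT[_ _ /gT].
      by rewrite /s' nw.
    move=> x y /setU1P[->|xT] /setU1P[->|yT] xy; first by rewrite eqxx in xy.
    + by left; apply: W.
    + by right; apply: W.
    + have [a|a] := ears_starts H xT yT xy; [left|right]; apply: S => //.
      by rewrite eq_sym.
by rewrite (gT u) // /g' eqxx.
Qed.

(** The vertices of the ear are added backwards from its end [v], each in front of its successor.
    Knowing the arcs that leave [w] serves to exclude an arc [w -> u] when the ear is closed. *)
Lemma ears_grow u v T D g s w ws : ears u u T D g s -> v \in T ->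
  path adj w (rcons ws v) -> uniq (w :: ws) -> all [predC T] (w :: ws) ->
  exists D' g' s',
    [/\ ears w u (T :|: [set x in w :: ws]) D' g' s', g' w != g' u &
      forall y, D' w y = (y == head v ws)].
Proof.
move=> H vT; elim: ws w => [|w' ws IH] w.
  rewrite /= andbT => wv _ /andP[wT _].
  (* Strong connectivity allows any vertex of [T] as the top. *)
  have H0 : ears v u T D g s.
    split; try (by case: H); try exact: vT.
    by move=> x xT; split; apply: (ears_strong H) => //; apply: ears_bot H.
  have [D' [g' [s' [H' ? ?]]]] := ears_add H0 wT wv.
  exists D', g', s'; split=> //.
  suff -> : T :|: [set x in [:: w]] = w |: T by [].
  by apply/setP=> x; rewrite !inE orbC.
move=> /andP[ww' p] /andP[wn un] /andP[wT alT].
have [D' [g' [s' [H' _ _]]]] := IH w' p un alT.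
have wn' : w \notin T :|: [set x in w' :: ws].
  by rewrite !inE negb_or wn andbT.
have [D2 [g2 [s2 [H2 ? ?]]]] := ears_add H' wn' ww'.
exists D2, g2, s2; split=> //.
suff -> : T :|: [set x in w :: w' :: ws] =
          w |: (T :|: [set x in w' :: ws]) by [].
by apply/setP=> x; rewrite !inE; case: (x \in T); case: (x == w).
Qed.

(** The arc [u -> t] restores strong connectivity. Directed paths are only gained, so the same [s]
    serves. *)
Lemma ears_close t u T D g s : ears t u T D g s ->
  adj u t -> g t != g u -> ~~ D t u -> t != u ->
  exists D' g' s', ears u u T D' g' s'.
Proof.
move=> H ut gtu Dtu tu.
pose D' : rel G := fun x y => D x y || ((x == u) && (y == t)).
have DD : subrel D D' by move=> x y; rewrite /D' => ->.
have CC x y : connect D x y -> connect D' x y.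
  by apply: connect_sub => a b /DD/connect1.
have tT := ears_top H; have uT := ears_bot H.
exists D', g, s; split=> //.
- by move=> x y /orP[/(ears_sub H)//|/andP[/eqP-> /eqP->]].
- move=> x y; rewrite /D' negb_or => /orP[xy|/andP[/eqP-> /eqP->]].
    rewrite (ears_asym H) //=; apply: contra Dtu => /andP[/eqP<- /eqP<-] //.
  by rewrite Dtu (negbTE tu).
- move=> x y /orP[/(ears_proper H)//|/andP[/eqP-> /eqP->]].
  by rewrite eq_sym.
- exact: ears_lt3 H.
- move=> x xT; have [tx xu] := ears_conn H xT; split; last exact: CC.
  by apply: connect_trans (CC _ _ tx); apply: connect1; rewrite /D' !eqxx orbT.
- move=> x y xT yT xy.
  have S a b : a != b -> starts D g s a b -> starts D' g s a b.
    by move=> ab; apply: starts_sub.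
  by have [a|a] := ears_starts H xT yT xy; [left|right]; apply: S;
    rewrite // eq_sym.
Qed.

Lemma first_entry (e : rel G) T w q : path e w q -> w \notin T ->
  last w q \in T -> uniq (w :: q) ->
  exists ws v, [/\ path e w (rcons ws v), v \in T, uniq (w :: ws),
    all [predC T] (w :: ws) & {subset ws <= q}].
Proof.
elim: q w => [|z q IH] w /=; first by move=> _ /negbTE->.
case/andP=> wz zq wT lT /andP[wn un].
have [zT|zT] := boolP (z \in T).
  by exists [::], z; split; rewrite //= ?wz ?wT.
have [ws [v [p vT u al sub]]] := IH z zq zT lT un.
exists (z :: ws), v; split=> //=; rewrite ?wz ?wT //.
  move: u; rewrite /= => ->; rewrite andbT.
  by apply: contra wn; rewrite !inE => /orP[->|/sub->]; rewrite ?orbT.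
by move=> x; rewrite !inE => /orP[->|/sub->]; rewrite ?orbT.
Qed.

(** As [uw] is not a bridge, a path from [w] to [u] avoids it. Cut at its first vertex [v] in [T],
    this path yields the ear [u -> w -> ... -> v]. *)
Lemma ears_ear u T D g s w : ears u u T D g s -> w \notin T ->
  nonbridge u w -> exists D' g' s' T',
  [/\ ears u u T' D' g' s', T \subset T' & w \in T'].
Proof.
move=> H wT; rewrite nonbridgeE // => /andP[uw cuw].
have uT := ears_bot H.
rewrite (minus_edge_sym u w u w) in cuw.
case/connectP: cuw => q0 q0P lq0; case/shortenP: q0P lq0 => q qP uq _ lq.
have lT : last w q \in T by rewrite -lq.
have [ws [v [p vT uws al _]]] := first_entry qP wT lT uq.
have sub : subrel (minus_edge u w) adj by move=> x y /andP[].
have [D' [g' [s' [H' gwu Dw]]]] := ears_grow H vT (sub_path sub p) uws al.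
have wu : w != u by apply: contraNneq wT => ->.
have [] := ears_close H' uw gwu _ wu.
  (* The successor of [w] is not [u]: it is either [v], reached by an edge other than [uw], or a
     vertex outside [T]. *)
  rewrite Dw; case: ws p {uws H' Dw} al => [|z ws] /=.
    rewrite andbT => /andP[_] + _; apply: contra => /eqP <-.
    by rewrite setUC inE.
  by move=> _ /and3P[_ zT _]; apply: contraNneq zT => <-.
move=> D2 [g2 [s2 H2]]; exists D2, g2, s2, (T :|: [set x in w :: ws]).
by split; rewrite ?subsetUl // !inE eqxx orbT.
Qed.

Lemma ears_rebase u v T D g s : ears u u T D g s -> v \in T ->
  ears v v T D g s.
Proof.
move=> H vT; have S := ears_strong H; split; try (by case: H); try exact: vT.
by move=> x xT; split; apply: S.
Qed.

(** A directed walk from [y] to [x], stopped at its first visit to [x], uses neither [x -> y] nor,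
    by asymmetry, [y -> x]. *)
Lemma ears_nonbridge u T D g s x y : ears u u T D g s -> D x y ->
  nonbridge x y.
Proof.
move=> H xy; have [axy xT yT] := ears_sub H xy.
rewrite nonbridgeE // axy /= minus_edge_sym.
apply: (connect_sub _ (connect_avoid (ears_strong H yT xT))) => a b.
case/andP=> ab ax; have [aab _ _] := ears_sub H ab.
apply/connect1/minus_edgeI => //; first by rewrite ax.
rewrite -negb_and; apply: contraTN ab => /andP[/eqP-> /eqP->].
exact: (ears_asym H xy).
Qed.

(** A set that no ear enlarges is closed under [nonbridge]; conversely, its vertices are joined by
    arcs, which are not bridges. *)
Lemma ears_exists (r : G) : exists T D g s, ears r r T D g s /\
  forall x, (x \in T) = connect nonbridge r x.
Proof.
suff [T [D [g [s [H cl]]]]] : exists T D g s, ears r r T D g s /\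
  forall x y, x \in T -> nonbridge x y -> y \in T.
  exists T, D, g, s; split=> // x; apply/idP/idP.
    move=> xT; apply: (connect_sub _ (ears_strong H (ears_top H) xT)) => a b.
    by move/(ears_nonbridge H)/connect1.
  case/connectP=> p; elim: p r {H} (ears_top H) => [|z p IH] r' rT /=.
    by move=> _ ->.
  by case/andP=> /(cl _ _ rT) zT /(IH _ zT).
have [T [D [g [s H]]]] := ears_init r.
have [n] := ubnP #|~: T|; elim: n T D g s H => // n IH T D g s H leT.
have [/'exists_existsP[x [y /and3P[xT yT xy]]]|cl] :=
  boolP [exists x, exists y, [&& x \in T, y \notin T & nonbridge x y]].
  have [D' [g' [s' [T' [H' sub yT']]]]] := ears_ear (ears_rebase H xT) yT xy.
  apply: (IH T' D' g' s').
    by apply: ears_rebase H' _; apply: (subsetP sub); apply: ears_top H.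
  rewrite -ltnS; apply: leq_trans leT; rewrite ltnS; apply: proper_card.
  by rewrite properEneq setCS sub andbT; apply: contraNneq yT => /setC_inj <-.
exists T, D, g, s; split=> // x y xT xy; apply: contraNT cl => yT.
by apply/existsP; exists x; apply/existsP; exists y; rewrite xT yT.
Qed.

End Ears.

(** * Proper paths *)

Section ProperPaths.
Variable G : sgraph.
Implicit Types (S X : {set G}) (col : G -> G -> nat) (e : rel G).

Definition neqn : rel nat := fun a b => a != b.

(* [a] and [b] are the colours of edges preceding and following the path; a
   number that is not a colour imposes no constraint. *)
Definition ppath e col X (a b : nat) (x y : G) : Prop :=
  exists p, [/\ path e x p, last x p = y, uniq (x :: p), {subset x :: p <= X} &
    path neqn a (rcons (pairmap col x p) b)].

Lemma pairmap_rev col x p : (forall a b, col a b = col b a) ->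
  pairmap col (last x p) (rev (belast x p)) = rev (pairmap col x p).
Proof.
move=> cs; elim/last_ind: p => // p y IH.
rewrite last_rcons belast_rcons -cats1 pairmap_cat rev_cat /= -IH.
case/lastP: p {IH} => [|q z] /=; first by rewrite cs.
by rewrite last_rcons belast_rcons -rcons_cons rev_rcons /= cs.
Qed.

Lemma ppath_sym e col X a b x y :
  symmetric e -> (forall u v, col u v = col v u) ->
  ppath e col X a b x y -> ppath e col X b a y x.
Proof.
move=> es cs [p [ep <- up sp cp]].
have revp : last x p :: rev (belast x p) = rev (x :: p).
  by rewrite [in RHS]lastI rev_rcons.
exists (rev (belast x p)); rewrite revp; split.
- by rewrite rev_path; rewrite (eq_path (e' := e)) // => u v; rewrite es.
- by rewrite -(last_cons x) revp rev_cons last_rcons.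
- by rewrite rev_uniq.
- by move=> u; rewrite mem_rev => /sp.
rewrite pairmap_rev // -rev_cons.
set l := pairmap _ _ _ in cp *.
suff : sorted neqn (b :: rcons (rev l) a).
  by rewrite /= -rev_cons.
have <- : rev (a :: rcons l b) = b :: rcons (rev l) a.
  by rewrite rev_cons rev_rcons.
rewrite rev_sorted; rewrite (eq_sorted (e' := neqn)) //.
by move=> u v; rewrite /neqn eq_sym.
Qed.

Lemma ppath_ext e col X a b k x y z : ppath e col X a b x y ->
  z \notin X -> e z x -> col z x = a -> k != a ->
  ppath e col (z |: X) k b z y.
Proof.
move=> [p [ep lp up sp cp]] zX zx ca ka; exists (x :: p); split=> //=.
- by rewrite zx.
- by rewrite -/(uniq (x :: p)) up andbT; apply: contra zX => /sp.
- by move=> u /predU1P[->|/sp ?]; rewrite ?setU11 // setU1r.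
- by rewrite ca cp andbT.
Qed.

Lemma ppath_sub e e' col col' X X' a b x y :
  {subset X <= X'} ->
  (forall u v, e u v -> e' u v /\ col' u v = col u v) ->
  ppath e col X a b x y -> ppath e' col' X' a b x y.
Proof.
move=> XX ee [p [ep lp up sp cp]]; exists p; split=> //.
- by apply: sub_path ep => u v /ee[].
- by move=> u /sp/XX.
suff -> : pairmap col' x p = pairmap col x p by [].
elim: p x ep {lp up sp cp} => //= z p IH x /andP[/ee[_ ->] /IH-> //].
Qed.

Lemma ppath_nil e col X a b x : x \in X -> a != b -> ppath e col X a b x x.
Proof.
move=> xX ab; exists [::]; split=> //=; rewrite ?andbT //.
by move=> u /predU1P[->|].
Qed.

End ProperPaths.

(** * Proper paths along an oriented ear decomposition *)

Section EarPaths.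
Variable G : sgraph.
Variables (u : G) (T : {set G}) (D : rel G) (g s : G -> nat) (e : rel G).
Variable col : G -> G -> nat.
Hypothesis earsT : ears u u T D g s.
Hypothesis esym : symmetric e.
Hypothesis colC : forall x y, col x y = col y x.
Hypothesis De : subrel D e.
Hypothesis colD : forall x y, D x y -> col x y = g y.

Lemma ears_pairmap x p : path D x p ->
  pairmap col x p = map g p /\ path neqn (g x) (map g p).
Proof.
elim: p x => //= y p IH x /andP[xy /IH[-> ->]]; rewrite colD //.
by rewrite /neqn (ears_proper earsT xy).
Qed.

Lemma ppath_arcs a b x y p : x \in T -> x != y -> path D x p ->
  last x p = y -> uniq (x :: p) -> a != g (head x p) -> b != g y ->
  ppath e col T a b x y.
Proof.
move=> xT xy pP lp up ha hb; exists p; split=> //.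
- exact: sub_path De _ _ pP.
- by move=> z /predU1P[->|/(allP (ears_path earsT pP))].
have [-> cp] := ears_pairmap pP.
rewrite rcons_path.
case: p lp pP up ha cp => [/= E|z p /= lp _ _ ha /andP[_ ->]].
  by rewrite E eqxx in xy.
by rewrite /neqn ha /= last_map lp eq_sym.
Qed.

(** The last arc of a directed path has colour [g y]. The first one, [x -> z], has colour [g z],
    which is below 3 and differs from [g x]. *)
Lemma ppath_strong a b x y : x \in T -> y \in T -> x != y ->
  a = g x \/ 2 < a -> b != g y -> ppath e col T a b x y.
Proof.
move=> xT yT xy ha hb.
have /connectP[p0 p0P] := ears_strong earsT xT yT.
case/shortenP: p0P => p pP up _ lp; apply: (ppath_arcs xT xy pP) => //.
case: p pP up lp => [_ _ /= E|z p /= /andP[xz _] _ _].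
  by rewrite E eqxx in xy.
case: ha => [->|]; first exact: (ears_proper earsT xz).
by apply: contraTneq => ->; rewrite -leqNgt -ltnS (ears_lt3 earsT).
Qed.

(** If [a = g x], a directed path from [x] to [y] serves; otherwise one from [y] to [x] read
    backwards, as it meets [x] with colour [g x]. *)
Lemma ppath_free a b x y : x \in T -> y \in T -> x != y -> 2 < b ->
  ppath e col T a b x y.
Proof.
move=> xT yT xy b2; have [E|ne] := eqVneq a (g x).
  apply: ppath_strong => //; first by left.
  by apply: contraTneq b2 => ->; rewrite -leqNgt -ltnS (ears_lt3 earsT).
by apply: ppath_sym => //; apply: ppath_strong => //; [rewrite eq_sym|right].
Qed.

Lemma ppath_starts a b x y : x \in T -> x != y -> starts D g s x y ->
  a != s x -> b != g y -> ppath e col T a b x y.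
Proof.
move=> xT xy [p [pP lp up <-]] ha hb; exact: ppath_arcs pP lp up ha hb.
Qed.

End EarPaths.

(** * Counting and list colouring on fibres *)

(** Each point of the image other than [t] uses up an element of [Z] outside the fibre of [t]. *)
Lemma fiber_card (aT rT : finType) (f : aT -> rT) (Z : {set aT}) t :
  t \in f @: Z ->
  #|[set z in Z | f z == t]| + #|f @: Z| <= #|Z|.+1.
Proof.
move=> tZ; rewrite (cardsD1 t (f @: Z)) tZ add1n addnS ltnS.
rewrite -(cardsID [set z | f z == t] Z) leq_add //.
  by rewrite subset_leq_card //; apply/subsetP=> z; rewrite !inE.
apply: leq_trans (leq_imset_card f _); apply: subset_leq_card.
apply/subsetP=> y; rewrite !inE => /andP[yt /imsetP[z zZ E]].
by apply/imsetP; exists z; rewrite // !inE -E yt.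
Qed.

(** Fibres are independent: the i-th element of a fibre takes the i-th colour below [k] that is not
    forbidden there. *)
Lemma list_coloring (aT rT : finType) (f : aT -> rT) (Z : {set aT})
    (F : rT -> seq nat) k :
  0 < k ->
  (forall t, #|[set z in Z | f z == t]| + size (F t) <= k) ->
  exists beta : aT -> nat,
    [/\ forall z, beta z < k, forall z, z \in Z -> beta z \notin F (f z) &
      forall z z', z \in Z -> z' \in Z -> z != z' -> f z = f z' ->
        beta z != beta z'].
Proof.
move=> k0 hF.
pose fib t := [set z in Z | f z == t].
pose cand t := [seq i <- iota 0 k | i \notin F t].
have szc t : #|fib t| <= size (cand t).
  rewrite -(leq_add2r (size (F t))); apply: leq_trans (hF t) _.
  rewrite -{1}(size_iota 0 k) -(count_predC (mem (F t)) (iota 0 k)) addnC.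
  rewrite size_filter leq_add2l -size_filter; apply: uniq_leq_size.
    by rewrite filter_uniq // iota_uniq.
  by move=> i; rewrite mem_filter => /andP[].
(* The default 0 can be returned only outside [Z], where nothing but [beta z < k] is claimed. *)
pose beta z := nth 0 (cand (f z)) (index z (enum (fib (f z)))).
have idx z : z \in Z -> index z (enum (fib (f z))) < size (cand (f z)).
  move=> zZ; apply: leq_trans (szc _); rewrite cardE index_mem mem_enum.
  by rewrite !inE zZ /=.
exists beta; split.
- move=> z; rewrite /beta; set i := index _ _.
  have [lti|gei] := ltnP i (size (cand (f z))); last by rewrite nth_default.
  by have := mem_nth 0 lti; rewrite mem_filter mem_iota => /andP[].
- by move=> z zZ; have := mem_nth 0 (idx z zZ); rewrite mem_filter => /andP[].
move=> z z' zZ z'Z zz' ff; have iz' := idx z' z'Z.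
rewrite -ff in iz'; rewrite /beta -ff nth_uniq ?idx //; last first.
  by rewrite filter_uniq // iota_uniq.
have enumZ : (z \in enum (fib (f z))) && (z' \in enum (fib (f z))).
  by rewrite !mem_enum !inE zZ z'Z ff eqxx.
case/andP: enumZ => zE z'E; apply: contraNneq zz' => E.
by rewrite -(nth_index z zE) E nth_index.
Qed.

(** * Colouring a component and its bridges *)

Section Blocks.
Variable G : sgraph.
Hypothesis Gconn : connected G.
Implicit Types (S C : {set G}) (col : G -> G -> nat).

Definition boundary S : {set G} :=
  [set z | (z \notin S) && [exists x in S, adj x z]].

Definition block_of (r : G) : {set G} := [set x | connect nonbridge r x].

Lemma nonbridge_minus (x z a b : G) : ~~ nonbridge x z ->
  connect nonbridge a b -> connect (minus_edge x z) a b.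
Proof.
move=> nxz; apply: connect_sub => {}a {}b ab; apply: connect1.
move: (ab); rewrite /nonbridge /minus_edge /del_adj /= => /andP[-> _] /=.
rewrite inE; apply: contra nxz => /eqP/set2_eq[][<- <-] //.
by rewrite /nonbridge del_adj_sym.
Qed.

Lemma bridge_separates (x z : G) : adj x z -> ~~ nonbridge x z ->
  ~~ connect (minus_edge x z) x z.
Proof. by move=> xz; rewrite nonbridgeE // xz. Qed.

(** If the two edges differed, going from [x] to [x'] inside the block, along [x'z'], and on to [z]
    would bypass the bridge [xz]. *)
Lemma block_bridge (r x x' z z' : G) :
  x \in block_of r -> x' \in block_of r -> z \notin block_of r ->
  adj x z -> adj x' z' -> connect nonbridge z z' -> x = x' /\ z = z'.
Proof.
rewrite !inE => rx rx' rz xz xz' zz'.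
have nxz : ~~ nonbridge x z.
  by apply: contra rz => /connect1; apply: connect_trans.
have := bridge_separates xz nxz.
have [/andP[/eqP-> /eqP->] //|ne] := boolP ((x' == x) && (z' == z)).
case/negP; apply: connect_trans (_ : connect _ x x') _.
  apply: nonbridge_minus => //; apply: connect_trans rx'.
  by rewrite nonbridge_sym.
apply: connect_trans (_ : connect _ x' z') _.
  apply/connect1/minus_edgeI => //; first by rewrite -negb_and.
  by apply/orP; left; apply: contraNneq rz => <-.
by apply: nonbridge_minus => //; rewrite nonbridge_sym.
Qed.

(** By [block_bridge], distinct boundary vertices lie in distinct components, each adjacent to the
    block in the tree. *)
Lemma card_boundary (r : G) :
  #|boundary (block_of r)| <= max_degree (bridge_tree G).
Proof.
pose P := components (del_edges (cut_edges G)) : {set {set G}}.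
have blockP z : block_of z \in P.
  apply/imsetP; exists z; first by rewrite inE.
  by apply/setP=> x; rewrite !inE.
pose b z : bridge_tree G := exist _ (block_of z) (blockP z).
apply: leq_trans (leq_bigmax (b r)).
have inj : {in boundary (block_of r) &, injective b}.
  move=> z z'; rewrite !inE => /andP[zr /exists_inP[x xr xz]].
  move=> /andP[zr' /exists_inP[x' xr' xz']] /(congr1 val) /= E.
  have zz' : connect nonbridge z z'.
    have : z' \in block_of z by rewrite E inE connect0.
    by rewrite inE.
  by have [] := block_bridge (r := r) xr xr' _ xz xz' zz'; rewrite ?inE.
rewrite -(card_in_imset inj); apply: subset_leq_card.
apply/subsetP=> _ /imsetP[z + ->].
rewrite !inE => /andP[zr /exists_inP[x xr xz]].
rewrite /adj /= /contract_adj; apply/andP; split.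
  apply: contra zr => /eqP/(congr1 val) /= E.
  have : z \in block_of r by rewrite E inE.
  by rewrite inE.
apply/exists_inP; exists x => //; apply/exists_inP; exists z => //.
by rewrite inE.
Qed.

Definition touch S : rel G := fun x y => adj x y && ((x \in S) || (y \in S)).

Lemma touch_sym S : symmetric (touch S).
Proof. by move=> x y; rewrite /touch adj_sym orbC. Qed.

(** For colourings with values below [k], the end colours [k] impose no constraint. *)
Definition linked k S col : Prop := forall x y,
  x \in S :|: boundary S -> y \in S :|: boundary S -> x != y ->
  ppath (touch S) col setT k k x y.

Lemma block_coloring (r : G) k : 2 < k ->
  #|boundary (block_of r)| <= k ->
  exists col, [/\ forall x y, col x y = col y x, forall x y, col x y < k &
    linked k (block_of r) col].
Proof.
move=> k2 leZ; set Z := boundary _ in leZ.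
have [T [D [g [s [earsT TE]]]]] := ears_exists Gconn r.
have ET : block_of r = T by apply/setP=> x; rewrite inE TE.
pose n z := odflt z [pick x in T | adj x z].
have nP z : z \in Z -> n z \in T /\ adj (n z) z.
  rewrite inE ET /n => /andP[_ /exists_inP[x xT xz]].
  by case: pickP => [y /andP[]|/(_ x)] //=; rewrite xT xz.
(* Since [#|Z| <= k], a fibre has at most [k + 1 - #|n @: Z|] elements, which leaves room for fewer
   than [#|n @: Z|] forbidden colours. *)
have fibF (F : G -> seq nat) : (forall t, t \notin n @: Z -> size (F t) <= k) ->
    (forall t, t \in n @: Z -> size (F t) < #|n @: Z|) ->
    forall t, #|[set z in Z | n z == t]| + size (F t) <= k.
  move=> F1 F2 t; have [tN|tN] := boolP (t \in n @: Z).
    have := fiber_card tN; move: (F2 t tN) => /= h1 h2.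
    rewrite -ltnS; apply: leq_trans (leq_trans h2 _); last by rewrite ltnS.
    by rewrite -addnS leq_add2l.
  rewrite (_ : [set z in Z | n z == t] = set0) ?cards0 ?F1 //.
  apply/setP=> z; rewrite in_set in_set0.
  by apply: contraNF tN => /andP[zZ /eqP <-]; apply: imset_f.
(* [F t] lists the colours forbidden for the bridges attached at [t]. *)
have [F [fF FP]] : exists F : G -> seq nat,
    (forall t, #|[set z in Z | n z == t]| + size (F t) <= k) /\
    forall x y, x \in n @: Z -> y \in n @: Z -> x != y ->
    (starts D g s x y /\ s x \in F x /\ g y \in F y) \/
    (starts D g s y x /\ s y \in F y /\ g x \in F x).
  have nT x : x \in n @: Z -> x \in T.
    by case/imsetP=> z /nP[? _] ->.
  have [N3|N2] := ltnP 2 #|n @: Z|.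
    exists (fun x => [:: g x; s x]); split.
      by apply: fibF => t _; [apply: ltnW|].
    move=> x y /nT xT /nT yT xy.
    by have [a|a] := ears_starts earsT xT yT xy; [left|right]; split=> //;
      rewrite !inE !eqxx orbT.
  have [N1|] := leqP #|n @: Z| 1.
    exists (fun=> [::]); split.
      by apply: fibF => t // tN; rewrite (cardsD1 t) tN.
    move=> x y xN yN; have /card_le1_eqP/(_ x y xN yN) -> := N1.
    by rewrite eqxx.
  case/card_gt1P=> t1 [t2 [t1N t2N t12]].
  have E : n @: Z = [set t1; t2].
    apply/eqP; rewrite eq_sym eqEcard cards2 t12 N2 andbT.
    by apply/subsetP=> x; rewrite !inE => /orP[]/eqP->.
  wlog st : t1 t2 t1N t2N t12 E / starts D g s t1 t2.
    move=> W; have [a|a] := ears_starts earsT (nT _ t1N) (nT _ t2N) t12.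
      exact: (W t1 t2).
    by apply: (W t2 t1) => //; rewrite ?E 1?eq_sym // setUC.
  (* The path from [t1] to [t2] leaves with colour [s t1] and arrives with [g t2]; forbidding one
     colour at each end suffices. *)
  exists (fun t => if t == t1 then [:: s t1] else [:: g t2]); split.
    have sF t : size (if t == t1 then [:: s t1] else [:: g t2]) = 1.
      by case: ifP.
    by apply: fibF => t _; rewrite sF ?E ?cards2 ?t12 // ltnW // ltnW.
  have t21 : (t2 == t1) = false by rewrite eq_sym (negbTE t12).
  move=> x y; rewrite E => /set2P[]-> /set2P[]->; rewrite ?eqxx // => _.
    by left; rewrite t21 !inE !eqxx.
  by right; rewrite t21 !inE !eqxx.
have [beta [bk bF bI]] := list_coloring (ltnW (ltnW k2)) fF.
(* Arcs take the colour of their head, edges leaving [T] the colour [beta] of their outer end; the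
   remaining 0 is arbitrary. *)
pose col x y := if D x y then g y else if D y x then g x else
  if x \in T then if y \in T then 0 else beta y
  else if y \in T then beta x else 0.
have colC x y : col x y = col y x.
  rewrite /col; have [xy|] := boolP (D x y).
    by rewrite (negbTE (ears_asym earsT xy)).
  by case: ifP => //; case: ifP => //; case: ifP.
have g3 x : g x < k by apply: leq_trans k2; apply: (ears_lt3 earsT).
exists col; split=> //.
  move=> x y; rewrite /col; have k0 := ltnW (ltnW k2).
  by do 4 ?case: ifP => // _.
rewrite ET.
have De : subrel D (touch T).
  by move=> x y /(ears_sub earsT)[xy xT _]; rewrite /touch xy xT.
have colD x y : D x y -> col x y = g y by rewrite /col => ->.
have es := @touch_sym T.
have Q X a b x y :
    ppath (touch T) col X b a y x -> ppath (touch T) col X a b x y.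
  exact: ppath_sym.
(* A boundary vertex is represented by its attachment vertex, with the colour of its bridge as end
   constraint. Paths between representatives are found inside [T] by [inner], and [outer] puts the
   bridges back. *)
pose node x := if x \in T then x else n x.
pose gam x := if x \in T then k else beta x.
have inner x y : x \in T :|: Z -> y \in T :|: Z -> x != y ->
    ppath (touch T) col T (gam x) (gam y) (node x) (node y).
  have dir a b x' y' : x' \in T -> x' != y' -> starts D g s x' y' ->
    a != s x' -> b != g y' -> ppath (touch T) col T a b x' y'.
    exact: (ppath_starts earsT).
  have free a b x' y' : x' \in T -> y' \in T -> x' != y' -> 2 < b ->
    ppath (touch T) col T a b x' y' by apply: (ppath_free earsT).
  have kb z : k != beta z.
    by rewrite eq_sym; apply: contraTneq (bk z) => ->; rewrite ltnn.
  have TZ z y' : z \in Z -> y' \in T ->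
      ppath (touch T) col T (beta z) k (n z) y'.
    move=> zZ yT; have [nT _] := nP z zZ; have [<-|ne] := eqVneq (n z) y'.
      by apply: ppath_nil; rewrite // eq_sym.
    exact: free.
  rewrite !in_setU /node /gam.
  have [xT _|_ /= xZ] := boolP (x \in T);
    have [yT _|_ /= yZ] := boolP (y \in T).
  - by move=> ?; apply: free.
  - by move=> _; apply/Q/TZ.
  - by move=> _; apply/TZ.
  move=> xy; have [[nxT _] [nyT _]] := (nP x xZ, nP y yZ).
  have [E|ne] := eqVneq (n x) (n y).
    by rewrite -E; apply: ppath_nil => //; apply: bI.
  have /= F1 := bF x xZ; have /= F2 := bF y yZ.
  have neF i c l : i \notin l -> c \in l -> i != c :> nat.
    by move=> il; apply: contraTneq => <-.
  case: (FP _ _ (imset_f n xZ) (imset_f n yZ) ne) => [] [st [s1 s2]].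
    by apply: dir => //; [apply: neF F1 s1|apply: neF F2 s2].
  apply: Q; apply: dir => //; first by rewrite eq_sym.
    by apply: neF F2 s1.
  by apply: neF F1 s2.
have outer (X : {set G}) x b w : x \in T :|: Z -> (x \in T) || (x \notin X) ->
    ppath (touch T) col X (gam x) b (node x) w ->
    ppath (touch T) col (x |: X) k b x w.
  rewrite in_setU /gam /node; case: ifP => [xT _ _|xT /= xZ xX].
    by apply: ppath_sub => // y yX; rewrite setU1r.
  move/ppath_ext; apply=> //; have [nT nx] := nP x xZ.
  - by rewrite /touch adj_sym nx nT orbT.
  - have nD y : ~~ D x y by apply: contraFN xT => /(ears_sub earsT)[].
    have nD' y : ~~ D y x by apply: contraFN xT => /(ears_sub earsT)[].
    by rewrite /col (negbTE (nD _)) (negbTE (nD' _)) xT nT.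
  by rewrite eq_sym; apply: contraTneq (bk x) => ->; rewrite ltnn.
move=> x y; rewrite -ET -/Z ET => xTZ yTZ xy.
have := inner x y xTZ yTZ xy.
move/(outer _ _ _ _ xTZ) => H1.
have /H1/Q H2 : (x \in T) || (x \notin T) by case: (x \in T).
have := outer _ _ _ _ yTZ _ H2.
have -> : (y \in T) || (y \notin x |: T).
  by rewrite !inE eq_sym (negbTE xy) /=; case: (y \in T).
by move=> /(_ isT)/Q; apply: ppath_sub.
Qed.

End Blocks.

(** * Gluing along bridges *)

Section Glue.
Variable G : sgraph.
Hypothesis Gconn : connected G.
Implicit Types (S C : {set G}) (col : G -> G -> nat).

Definition inner S : rel G := fun x y => [&& adj x y, x \in S & y \in S].

(** Such a set is a union of components of [G] minus its bridges; all edges leaving it are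
    bridges. *)
Definition bridge_closed S : Prop :=
  forall x y, x \in S -> nonbridge x y -> y \in S.

Definition swapn (a b x : nat) : nat :=
  if x == a then b else if x == b then a else x.

Lemma swapn_inj a b : injective (swapn a b).
Proof.
move=> x y; rewrite /swapn.
by do 4 ?case: eqP => ? //; subst; congruence.
Qed.

Lemma ppath_recolor e col X k x y (f : nat -> nat) : injective f -> f k = k ->
  ppath e col X k k x y -> ppath (G := G) e (fun a b => f (col a b)) X k k x y.
Proof.
move=> finj fk [p [ep lp up sp cp]]; exists p; split=> //.
have -> : pairmap (fun a b => f (col a b)) x p = map f (pairmap col x p).
  by elim: p x {ep lp up sp cp} => //= z p IH x; rewrite IH.
rewrite -[in rcons _ k]fk -map_rcons -{1}fk path_map.
by rewrite (eq_path (e' := neqn)) // => a b; rewrite /= /neqn (inj_eq finj).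
Qed.

Lemma touch_path S x p : x \in S :|: boundary S -> path (touch S) x p ->
  {subset x :: p <= S :|: boundary S}.
Proof.
elim: p x => [|z p IH] x xS /=; first by move=> _ y; rewrite inE => /eqP->.
case/andP=> /andP[xz tz] zp y; rewrite inE => /predU1P[->//|].
apply: IH => //; rewrite !inE; have [//|zS /=] := boolP (z \in S).
by apply/exists_inP; exists x => //; rewrite (negbTE zS) orbF in tz.
Qed.

Lemma block_closed v : bridge_closed (block_of v).
Proof. by move=> x y; rewrite !inE => vx /connect1; apply: connect_trans. Qed.

Lemma inner_connect S x y : bridge_closed S -> x \in S ->
  connect nonbridge x y -> connect (inner S) x y.
Proof.
move=> cl + /connectP[p]; elim: p x => [|z p IH] x xS /=.
  by move=> _ ->; apply: connect0.
case/andP=> xz zp lp; have zS := cl _ _ xS xz.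
apply: connect_trans (IH z zS zp lp); apply: connect1.
by move: xz => /andP[xz _]; rewrite /inner xz xS.
Qed.

Lemma block_inner v x y : x \in block_of v -> y \in block_of v ->
  connect (inner (block_of v)) x y.
Proof.
move=> xv yv; apply: inner_connect => //; first exact: block_closed.
move: xv yv; rewrite !inE => xv; apply: connect_trans.
by rewrite nonbridge_sym.
Qed.

(** Both colourings cover the bridge [uv]. Once they agree on it, a path ending with [uv] and one
    beginning with [uv] merge along this edge. *)
Lemma glue k S col colC u v :
  bridge_closed S -> {in S &, forall x y, connect (inner S) x y} ->
  (forall x y, col x y = col y x) -> (forall x y, col x y < k) ->
  (forall x y, colC x y = colC y x) -> (forall x y, colC x y < k) ->
  u \in S -> v \notin S -> adj u v ->
  linked k S col -> linked k (block_of v) colC ->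
  exists col', [/\ forall x y, col' x y = col' y x, forall x y, col' x y < k &
    linked k (S :|: block_of v) col'].
Proof.
move=> clS conS cs ck csC ckC uS vS uv LS LC; set C := block_of v.
have vC : v \in C by rewrite inE connect0.
have SC x : x \in S -> x \notin C.
  move=> xS; rewrite inE nonbridge_sym; apply: contra vS.
  case/connectP=> p; elim: p x xS => [|z p IH] x xS /=; first by move=> _ ->.
  by case/andP=> xz; apply: IH; apply: clS xz.
set e := minus_edge u v.
have nuv : ~~ connect e u v.
  by apply: bridge_separates => //; apply: contra vS; apply: clS.
have eU x : x \in S -> connect e u x.
  move=> xS; apply: (connect_sub _ (conS _ _ uS xS)) => a b /and3P[ab aS bS].
  by apply/connect1/minus_edgeI => //; apply/orP;
    [right; apply: contraNneq vS => <-|left; apply: contraNneq vS => <-].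
have eV x : x \in C -> connect e v x.
  rewrite inE => /nonbridge_minus; apply.
  by apply: contra vS; apply: clS.
have eUV x : connect e u x -> connect e v x -> False.
  move=> ux vx; case/negP: nuv; apply: connect_trans ux _.
  by rewrite minus_edge_sym.
(* The sides of [u] and [v] are disjoint once [uv] is deleted, so no other edge joins them. *)
have cross x y : connect e u x -> connect e v y -> adj x y -> x = u /\ y = v.
  move=> ux vy xy.
  have [/andP[/eqP-> /eqP->] //|ne] := boolP ((x == u) && (y == v)).
  case: (eUV y) => //; apply: (connect_trans ux); apply: connect1.
  apply: minus_edgeI => //; first by rewrite -negb_and.
  by apply/orP; left; apply: contraNneq nuv => E; rewrite -E.
have plusS x : x \in S :|: boundary S -> x = v \/ connect e u x.
  rewrite in_setU => /orP[/eU|]; first by right.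
  rewrite inE => /andP[xS /exists_inP[w wS wx]].
  have [->|xv] := eqVneq x v; first by left.
  right; apply: connect_trans (eU _ wS) _; apply/connect1/minus_edgeI => //.
    by rewrite xv orbT.
  by apply/orP; left; apply: contraNneq vS => <-.
have plusC x : x \in C :|: boundary C -> x = u \/ connect e v x.
  rewrite in_setU => /orP[/eV|]; first by right.
  rewrite inE => /andP[xS /exists_inP[w wS wx]].
  have [->|xu] := eqVneq x u; first by left.
  right; apply: connect_trans (eV _ wS) _; apply/connect1/minus_edgeI => //.
    by apply/orP; left; apply: contraTneq wS => ->; apply: SC.
  by rewrite xu orbT.
(* This transposition makes [colC] agree with [col] on [uv]; both swapped colours are below [k], so
   [k] is fixed. *)
pose sw := swapn (colC u v) (col u v).
have swk c : c < k -> sw c < k by rewrite /sw /swapn; do 2 ?case: ifP.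
have swkk : sw k = k.
  rewrite /sw /swapn; case: eqP => [E|_].
    by have := ckC u v; rewrite -E ltnn.
  by case: eqP => // E; have := ck u v; rewrite -E ltnn.
pose col' x y := if (x \in C) || (y \in C) then sw (colC x y) else col x y.
have cs' x y : col' x y = col' y x by rewrite /col' orbC csC cs.
have subS x y : touch S x y -> touch (S :|: C) x y /\ col' x y = col x y.
  have swuv : sw (colC u v) = col u v by rewrite /sw /swapn eqxx.
  rewrite /touch /col' => /andP[xy xyS]; split.
    by rewrite xy !inE; case/orP: xyS => ->; rewrite ?orbT.
  case: ifP => // xyC; case/orP: xyS => zS; move: (SC _ zS) => /negbTE zC;
    rewrite zC ?orbF /= in xyC.
    by have [-> ->] := cross _ _ (eU _ zS) (eV _ xyC) xy.
  rewrite adj_sym in xy; have [-> ->] := cross _ _ (eU _ zS) (eV _ xyC) xy.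
  by rewrite csC swuv cs.
have subC x y : touch C x y -> touch (S :|: C) x y /\ col' x y = sw (colC x y).
  rewrite /touch /col' => /andP[xy xyC]; rewrite xyC; split=> //.
  by rewrite xy !in_setU; case/orP: xyC => ->; rewrite ?orbT.
exists col'; split=> //.
  by move=> x y; rewrite /col'; case: ifP => _ //; apply: swk.
have LS' x y : x \in S :|: boundary S -> y \in S :|: boundary S -> x != y ->
    exists p, [/\ path (touch S) x p, last x p = y, uniq (x :: p) &
    path neqn k (rcons (pairmap col' x p) k)].
  move=> xS yS xy.
  have [||q [? ? ? _ ?]] := ppath_sub (e' := touch S)
    (col' := col') (X' := setT) _ _ (LS x y xS yS xy) => //; last by exists q.
  by move=> a b ab; have [_ ->] := subS a b ab.
have LC' x y : x \in C :|: boundary C -> y \in C :|: boundary C -> x != y ->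
    exists p, [/\ path (touch C) x p, last x p = y, uniq (x :: p) &
    path neqn k (rcons (pairmap col' x p) k)].
  move=> xC yC xy; have L := LC x y xC yC xy.
  have L' := ppath_recolor (@swapn_inj (colC u v) (col u v)) swkk L.
  have [||q [? ? ? _ ?]] := ppath_sub (e' := touch C)
    (col' := col') (X' := setT) _ _ L' => //; last by exists q.
  by move=> a b ab; have [_ ->] := subC a b ab.
have pS x p : path (touch S) x p -> path (touch (S :|: C)) x p.
  by apply: sub_path => a b /subS[].
have pC x p : path (touch C) x p -> path (touch (S :|: C)) x p.
  by apply: sub_path => a b /subC[].
have main x y : x \in S :|: boundary S -> y \in C :|: boundary C ->
    x != v -> y != u -> ppath (touch (S :|: C)) col' setT k k x y.
  move=> xS yC xv yu.
  have vS' : v \in S :|: boundary S.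
    by rewrite !inE (negbTE vS) /=; apply/exists_inP; exists u.
  have uC' : u \in C :|: boundary C.
    rewrite in_setU [_ \in boundary _]inE (SC _ uS) /= orbC.
    by apply/orP; left; apply/exists_inP; exists v => //; rewrite adj_sym.
  (* By [cross], the path from [x] to [v] must end with the edge [uv], and the path from [u] to [y]
     must begin with it. *)
  have [p [pp lp up cp]] := LS' x v xS vS' xv.
  have uy : u != y by rewrite eq_sym.
  have [q [pq lq uq cq]] := LC' u y uC' yC uy.
  case/lastP: p pp lp up cp => [_ /= E|p v']; first by rewrite E eqxx in xv.
  rewrite last_rcons => pp E; rewrite {v'}E in pp *.
  case: q pq lq uq cq => [_ /= E|v' q pq]; first by rewrite E eqxx in uy.
  have Ev : v' = v.
    move: (pq) => /= /andP[/andP[uv' h] _]; rewrite (negbTE (SC _ uS)) /= in h.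
    by have [] := cross u v' (connect0 _ _) (eV _ h) uv'.
  rewrite {v'}Ev in pq *.
  have Eu : last x p = u.
    move: (pp); rewrite rcons_path => /andP[_ /andP[uv' h]].
    rewrite (negbTE vS) orbF in h.
    by have [] := cross _ v (eU _ h) (connect0 _ _) uv'.
  move=> lq uq cq up cp; exists (rcons p v ++ q); split=> //.
  - rewrite cat_path pS // last_rcons /=.
    by have := pC _ _ pq; rewrite /= => /andP[].
  - by rewrite last_cat last_rcons.
  - rewrite -cat_cons cat_uniq up /=; move: (uq) => /= /and3P[unq vnq ->].
    (* A common vertex would be [v], [u] or on both sides of the bridge; the second path has already
       passed [u] and [v]. *)
    rewrite andbT; apply/hasPn=> z zq; apply/negP=> zp.
    have zC : z \in C :|: boundary C.
      by apply: (touch_path uC' pq); rewrite !inE zq !orbT.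
    have zS := touch_path xS pp zp.
    case: (plusS _ zS) => [E|uz]; first by rewrite -E zq in vnq.
    case: (plusC _ zC) => [E|]; last exact: eUV.
    by rewrite -E !inE zq orbT in unq.
  - by move=> z _; rewrite inE.
  (* The colour of [uv] is last in one sequence and first in the other, so overlapping them there
     creates no new pair of consecutive colours. *)
  have P : pairmap col' x (rcons p v) = rcons (pairmap col' x p) (col' u v).
    by rewrite -!cats1 pairmap_cat /= Eu.
  move: cp cq; rewrite P rcons_path => /andP[cp _] /= /andP[_ cq].
  by rewrite pairmap_cat P last_rcons rcons_cat cat_path cp last_rcons.
have split x : x \in (S :|: C) :|: boundary (S :|: C) ->
    (x \in S :|: boundary S) || (x \in C :|: boundary C).
  rewrite !in_setU; case/orP=> [/orP[->//|->]|]; first by rewrite !orbT.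
  rewrite inE in_setU negb_or => /andP[/andP[xS xC] /exists_inP[w]].
  rewrite in_setU ![_ \in boundary _]inE xS xC => /orP[] wS wx; apply/orP.
    by left; rewrite orbC; apply/orP; left; apply/exists_inP; exists w.
  by right; rewrite orbC; apply/orP; left; apply/exists_inP; exists w.
move=> x y /split xP /split yP xy.
have mainS : x \in S :|: boundary S -> y \in S :|: boundary S ->
    ppath (touch (S :|: C)) col' setT k k x y.
  move=> xS yS; have [p [pp lp up cp]] := LS' x y xS yS xy.
  by exists p; split=> //; [exact: pS|move=> z _; rewrite inE].
have mainC : x \in C :|: boundary C -> y \in C :|: boundary C ->
    ppath (touch (S :|: C)) col' setT k k x y.
  move=> xS yS; have [p [pp lp up cp]] := LC' x y xS yS xy.
  by exists p; split=> //; [exact: pC|move=> z _; rewrite inE].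
have [xS|xS] := boolP (x \in S :|: boundary S);
  have [yS|yS] := boolP (y \in S :|: boundary S).
- exact: mainS.
- rewrite (negbTE yS) /= in yP.
  have [xC|xC] := boolP (x \in C :|: boundary C); first exact: mainC.
  apply: main => //.
    by apply: contraNneq xC => ->; rewrite in_setU vC.
  by apply: contraNneq yS => ->; rewrite in_setU uS.
- rewrite (negbTE xS) /= in xP.
  have [yC|yC] := boolP (y \in C :|: boundary C); first exact: mainC.
  apply: ppath_sym; [exact: touch_sym|by []|apply: main => //].
    by apply: contraNneq yC => ->; rewrite in_setU vC.
  by apply: contraNneq xS => ->; rewrite in_setU uS.
- by rewrite (negbTE xS) /= in xP; rewrite (negbTE yS) /= in yP; apply: mainC.
Qed.

(** Starting from the block of [r], whole blocks are added across edges leaving the current set; by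
    connectivity this stops only at the whole graph. *)
Lemma exists_linked k : 2 < k -> max_degree (bridge_tree G) <= k ->
  exists col, [/\ forall x y, col x y = col y x, forall x y, col x y < k &
    linked k [set: G] col].
Proof.
move=> k2 dk; have [/card_gt0P[r _] conn] := Gconn.
have blk v := block_coloring Gconn k2 (leq_trans (card_boundary Gconn v) dk).
pose ok S := [/\ bridge_closed S, {in S &, forall x y, connect (inner S) x y} &
  exists col, [/\ forall x y, col x y = col y x, forall x y, col x y < k &
    linked k S col]].
suff [S [[rS [_ _ okS]] cl]] : exists S : {set G}, (r \in S /\ ok S) /\
    forall x y, x \in S -> adj x y -> y \in S.
  suff <- : S = [set: G] by [].
  apply/setP=> x; rewrite inE; have /connectP[p] := conn r x.
  elim: p r rS => [|z p IH] t tS /=; first by move=> _ ->.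
  by case/andP=> tz; apply: IH; apply: cl tz.
have: r \in block_of r /\ ok (block_of r).
  split; first by rewrite inE connect0.
  split; [exact: block_closed| |exact: blk].
  by move=> x y; apply: block_inner.
move: (block_of r) => S; have [n] := ubnP #|~: S|; elim: n S => // n IH S leS.
move=> [rS [clS conS okS]].
have [/'exists_existsP[u [v /and3P[uS vS uv]]]|cl] :=
  boolP [exists x, exists y, [&& x \in S, y \notin S & adj x y]]; last first.
  exists S; split=> // x y xS xy; apply: contraNT cl => yS.
  by apply/existsP; exists x; apply/existsP; exists y; rewrite xS yS.
have vv : v \in block_of v by rewrite inE connect0.
apply: (IH (S :|: block_of v)).
  rewrite -ltnS; apply: leq_trans leS; rewrite ltnS; apply: proper_card.
  rewrite properEneq setCS subsetUl andbT; apply: contraNneq vS.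
  by move/setC_inj=> <-; rewrite in_setU vv orbT.
split; first by rewrite in_setU rS.
have innerS : subrel (inner S) (connect (inner (S :|: block_of v))).
  by move=> x y /and3P[xy xS yS]; rewrite connect1 // /inner xy !in_setU xS yS.
have innerC : subrel (inner (block_of v)) (connect (inner (S :|: block_of v))).
  move=> x y /and3P[xy xS yS]; rewrite connect1 // /inner xy !in_setU xS yS.
  by rewrite !orbT.
have inner_sym : connect_sym (inner (S :|: block_of v)).
  by apply: sym_connect_sym => x y; rewrite /inner adj_sym andbCA andbC -andbA.
split.
- move=> x y; rewrite !in_setU => /orP[xS xy|xv xy].
    by rewrite (clS _ _ xS xy).
  by rewrite (block_closed xv xy) orbT.
- have cross x y : x \in S -> y \in block_of v ->
      connect (inner (S :|: block_of v)) x y.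
    move=> xS yv; apply: connect_trans (_ : connect _ x u) _.
      exact: connect_sub innerS _ _ (conS _ _ xS uS).
    apply: connect_trans (_ : connect _ u v) _.
      by apply: connect1; rewrite /inner uv !in_setU uS vv orbT.
    exact: connect_sub innerC _ _ (block_inner vv yv).
  move=> x y; rewrite !in_setU => /orP[xS|xv] /orP[yS|yv].
  + exact: connect_sub innerS _ _ (conS _ _ xS yS).
  + exact: cross.
  + by rewrite inner_sym; apply: cross.
  + exact: connect_sub innerC _ _ (block_inner xv yv).
have [col [cs ck LS]] := okS; have [colC [csC ckC LC]] := blk v.
exact: glue uS vS uv LS LC.
Qed.

End Glue.

(** * From symmetric functions to edge colourings *)

Section EdgeColorings.
Variable G : sgraph.

Lemma path_edges_notin (x y : G) p A : x \notin y :: p ->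
  A \in path_edges y p -> x \notin A.
Proof.
elim: p y => //= z p IH y; rewrite !inE !negb_or => /and3P[xy xz xp].
case/predU1P=> [->|]; first by rewrite !inE negb_or xy.
by apply: IH; rewrite inE negb_or xz.
Qed.

(** On a path without repeated vertices, two distinct edges that share a vertex are consecutive. *)
Lemma path_edges_proper (kappa : {set G} -> nat) (x : G) p A B :
  uniq (x :: p) ->
  sorted neqn (pairmap (fun a b => kappa [set a; b]) x p) ->
  A \in path_edges x p -> B \in path_edges x p ->
  A != B -> A :&: B != set0 -> kappa A != kappa B.
Proof.
have first y z q C : y \notin z :: q -> uniq (z :: q) ->
    path neqn (kappa [set y; z]) (pairmap (fun a b => kappa [set a; b]) z q) ->
    C \in path_edges z q -> [set y; z] :&: C != set0 ->
    kappa [set y; z] != kappa C.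
  move=> ynzq uq pq Cq /set0Pn[w]; rewrite inE => /andP[+ wC].
  case/set2P=> E; rewrite E in wC.
    by rewrite (negbTE (path_edges_notin ynzq Cq)) in wC.
  case: q {ynzq} uq pq Cq => //= t q /andP[znq _] /andP[neq _].
  by case/predU1P=> [->//|/(path_edges_notin znq)]; rewrite wC.
elim: p x => //= z p IH x /andP[xn uzp] cp.
rewrite !inE => /predU1P[->|Ap] /predU1P[->|Bp] AB I0.
- by rewrite eqxx in AB.
- exact: first xn uzp cp Bp I0.
- by rewrite eq_sym; apply: first xn uzp cp Ap _; rewrite setIC.
- by apply: (IH z) => //; apply: path_sorted cp.
Qed.

Lemma edge_coloring k (col : G -> G -> nat) :
  (forall x y, col x y = col y x) -> (forall x y, col x y < k) ->
  linked k [set: G] col -> exists c : edge G -> 'I_k, proper_path_coloring c.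
Proof.
move=> cs ck L.
(* An edge takes the colour of any ordered pair of its ends; symmetry of [col] makes the choice
   irrelevant. *)
pose kappa (A : {set G}) : nat :=
  if [pick p : G * G | A == [set p.1; p.2]] is Some p then col p.1 p.2 else k.
have kappaE x y : kappa [set x; y] = col x y.
  rewrite /kappa.
  case: pickP => [[a b] /= /eqP/set2_eq[][-> ->]|/(_ (x, y))] //.
  by rewrite eqxx.
have kappa_lt (a : edge G) : kappa (val a) < k.
  by case: a => A /= /imsetP[[x y] _ ->]; rewrite kappaE.
exists (fun a => Ordinal (kappa_lt a)) => x y xy.
have [|| p [pp lp up _ cp]] := L x y _ _ xy; rewrite ?in_setU ?in_setT //.
have padj : path adj x p by apply: sub_path pp => a b /andP[].
exists p; first by rewrite /is_path padj lp eqxx up.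
move=> a b ap bp /andP[ab I0].
suff : kappa (val a) != kappa (val b) by [].
apply: path_edges_proper up _ ap bp _ I0; last by rewrite (inj_eq val_inj).
rewrite (_ : pairmap _ x p = pairmap col x p); last first.
  by elim: p x {padj pp lp cp xy} => //= z p IH x; rewrite kappaE IH.
by move: cp; rewrite rcons_path => /andP[/path_sorted].
Qed.

End EdgeColorings.

Theorem theorem3p6 (G : sgraph) (Gconn : connected G) :
  pc Gconn <= maxn 3 (max_degree (bridge_tree G)).
Proof.
have [col [cs ck L]] := exists_linked Gconn (leq_maxl _ _) (leq_maxr _ _).
rewrite /pc; case: ex_minnP => m _; apply.
by apply/asboolP; apply: edge_coloring cs ck L.
Qed.
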